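(* Assume that Cauchy problems for the RBK system with initial data in $X_1^+$ have unique solutions. Then for every $p\in\mathbb N$ the set $$X^{\le p}:=\{c\in X_1^+ : c_j=0\ \text{for all } j>p\}$$ is positively invariant for the RBK system; that is, if $c$ is a solution with $c(\tau)\in X^{\le p}$ for some $\tau\ge 0$ in its interval of definition, then $c(t)\in X^{\le p}$ for all $t\ge\tau$ in that interval.
   Context: The rate coefficients $a_{j,k}$ ($j,k\in\mathbb N=\{1,2,\dots\}$) are real with $a_{j,k}=a_{k,j}\ge 0$. The Redner--Ben-Avraham--Kahng (RBK) system is $$\frac{dc_j}{dt}=\sum_{k=1}^\infty a_{j+k,k}c_{j+k}c_k-\sum_{k=1}^\infty a_{j,k}c_jc_k,\qquad j\in\mathbb N.$$ $X_1=\{x=(x_j)\in\mathbb R^{\mathbb N}: \|x\|_1:=\sum_{j=1}^\infty j|x_j|<\infty\}$ and $X_1^+=\{x\in X_1: x_j\ge 0\ \forall j\}$. Definition (solution). Let $T\in(0,+\infty]$. A (mild) solution of the RBK system on $[0,T)$ with $c(0)=c_0\in X_1^+$ is a function $c=(c_j):[0,T)\to X_1^+$ such that: (i) each $c_j:[0,T)\to[0,\infty)$ is continuous and $\sup_{t\in[0,T)}\|c(t)\|_1<\infty$; (ii) for all $j\in\mathbb N$ and $t\in[0,T)$, $\int_0^t\sum_{k=1}^\infty a_{j,k}c_k(s)\,ds<\infty$; (iii) for all $j\in\mathbb N$ and $t\in[0,T)$, $$c_j(t)=c_{0j}+\int_0^t\Big[\sum_{k=1}^\infty a_{j+k,k}c_{j+k}(s)c_k(s)-\sum_{k=1}^\infty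 a_{j,k}c_j(s)c_k(s)\Big]ds.$$ Uniqueness means: for every $T\in(0,+\infty]$, two solutions on $[0,T)$ with the same initial condition $c_0\in X_1^+$ coincide. *)

(* Defs.v *)
From HB Require Import structures.
From mathcomp Require Import all_boot all_order all_algebra.
From mathcomp Require Import all_classical all_reals all_analysis.
Set Implicit Arguments.
Unset Strict Implicit.
Unset Printing Implicit Defensive.
Import Order.TTheory GRing.Theory Num.Theory.
Import numFieldNormedType.Exports.
Local Open Scope classical_set_scope.
Local Open Scope ring_scope.

(* Sequences indexed by {1, 2, ...} are functions on nat whose value at 0 is
   never inspected: sums start at 1 and quantified indices are positive.
   Series and integrals are taken in \bar R, where a divergent series of
   nonnegative terms is +oo. *)

Definition norm1 (R : realType) (x : nat -> R) : \bar R :=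
  (\sum_(1 <= j <oo) (j%:R * `|x j|)%:E)%E.

Definition X1 (R : realType) : set (nat -> R) :=
  [set x | (norm1 x < +oo)%E].

Definition X1plus (R : realType) : set (nat -> R) :=
  [set x | X1 x /\ forall j : nat, (0 < j)%N -> 0 <= x j].

Definition Xle (R : realType) (p : nat) : set (nat -> R) :=
  [set x | X1plus x /\ forall j : nat, (p < j)%N -> x j = 0].

(* The interval [0, T), with T possibly +oo. *)
Definition time_dom (R : realType) (T : \bar R) : set R :=
  [set t | 0 <= t /\ (t%:E < T)%E].

Definition rbk_gain (R : realType) (a : nat -> nat -> R) (x : nat -> R)
    (j : nat) : \bar R :=
  (\sum_(1 <= k <oo) (a (j + k)%N k * x (j + k)%N * x k)%:E)%E.

Definition rbk_loss (R : realType) (a : nat -> nat -> R) (x : nat -> R)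
    (j : nat) : \bar R :=
  (\sum_(1 <= k <oo) (a j k * x j * x k)%:E)%E.

(* A solution is represented by a total function of time, of which only the
   values on [0, T) matter.  The last clause is an equality in \bar R with a
   finite left-hand side.  By the clause before it the loss term is integrable
   on [0, t], so the equality forces the integrand to be integrable; +oo - +oo
   can only occur on a null set. *)
Record rbk_solution (R : realType) (a : nat -> nat -> R) (T : \bar R)
    (c0 : nat -> R) (c : R -> nat -> R) : Prop := RbkSolution {
  rbk_T_gt0 : (0 < T)%E ;
  rbk_c0_X1plus : X1plus c0 ;
  rbk_init : forall j : nat, (0 < j)%N -> c 0 j = c0 j ;
  rbk_X1plus : forall t : R, time_dom T t -> X1plus (c t) ;
  rbk_continuous : forall j : nat, (0 < j)%N ->
    {within time_dom T, continuous (fun t : R => c t j)} ;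
  rbk_bounded : (ereal_sup [set norm1 (c t) | t in time_dom T] < +oo)%E ;
  rbk_integrable : forall (j : nat) (t : R), (0 < j)%N -> time_dom T t ->
    (\int[@lebesgue_measure R]_(s in `[0%R, t])
       (\sum_(1 <= k <oo) (a j k * c s k)%:E) < +oo)%E ;
  rbk_mild : forall (j : nat) (t : R), (0 < j)%N -> time_dom T t ->
    ((c t j)%:E = (c0 j)%:E +
       \int[@lebesgue_measure R]_(s in `[0%R, t])
         (rbk_gain a (c s) j - rbk_loss a (c s) j))%E
}.

Definition rbk_uniqueness (R : realType) (a : nat -> nat -> R) : Prop :=
  forall (T : \bar R) (c0 : nat -> R) (c d : R -> nat -> R),
    rbk_solution a T c0 c -> rbk_solution a T c0 d ->
    forall t : R, time_dom T t -> forall j : nat, (0 < j)%N -> c t j = d t j.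

Definition rbk_positively_invariant (R : realType) (a : nat -> nat -> R)
    (S : set (nat -> R)) : Prop :=
  forall (T : \bar R) (c0 : nat -> R) (c : R -> nat -> R),
    rbk_solution a T c0 c ->
    forall tau : R, time_dom T tau -> S (c tau) ->
    forall t : R, time_dom T t -> tau <= t -> S (c t).

(* Main.v *)
(* On states supported in [1, p] the RBK system is a quadratic ODE in dimension
   p, so from a state c(t0) supported in [1, p] there is a nonnegative solution
   y supported in [1, p] on a time interval [t0, t0 + d].  Following c up to t0
   and y afterwards gives another solution with the initial condition of c, and
   uniqueness forces c = y on [t0, t0 + d).  Since d depends only on a bound for
   the components of c, and sup_t |c(t)|_1 is finite, finitely many such steps
   reach any time.
   The ODE is solved by Picard iteration after clamping the components to
   [0, M]: the clamped field is bounded and Lipschitz, and its j-th component is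
   nonnegative when x_j <= 0, which keeps y nonnegative. *)
Require Import Defs.
From HB Require Import structures.
From mathcomp Require Import all_boot all_order all_algebra.
From mathcomp Require Import all_classical all_reals all_analysis.
From mathcomp Require Import measurable_realfun ring lra.
Import Order.TTheory GRing.Theory Num.Theory.
Import numFieldNormedType.Exports.
Local Open Scope classical_set_scope.
Local Open Scope ring_scope.

(** * Elementary facts on real numbers *)

Lemma clamp_nonexpansive {R : realDomainType} (lo hi s t : R) :
  `|Num.max lo (Num.min hi s) - Num.max lo (Num.min hi t)| <= `|s - t|.
Proof.
have maxn (a x y : R) : `|Num.max a x - Num.max a y| <= `|x - y|.
  have [?|?] := leP a x; have [?|?] := leP a y;
    rewrite ler_norml; have := ler_norm (x - y); have := ler_norm (y - x);
    rewrite [`|y - x|]distrC; move: `|x - y| => r ? ?; apply/andP; split; lra.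
have minn (a x y : R) : `|Num.min a x - Num.min a y| <= `|x - y|.
  have [?|?] := leP a x; have [?|?] := leP a y;
    rewrite ler_norml; have := ler_norm (x - y); have := ler_norm (y - x);
    rewrite [`|y - x|]distrC; move: `|x - y| => r ? ?; apply/andP; split; lra.
exact: le_trans (maxn _ _ _) (minn _ _ _).
Qed.

(** Nested intervals: with [e n] the tail of the geometric series, the intervals from [u n - e n] to
    [u n + e n] decrease, and the supremum of their left ends lies in all of them. *)
Lemma geometric_limit (R : realType) (C : R) (u : nat -> R) :
    (forall n, `|u n.+1 - u n| <= C / 2 ^+ n) ->
  exists l, forall n, `|l - u n| <= 2 * C / 2 ^+ n.
Proof.
move=> uC.
have C0 : 0 <= C.
  by have := le_trans (normr_ge0 _) (uC 0); rewrite expr0 divr1.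
pose e n : R := 2 * C / 2 ^+ n.
have eS n : e n = e n.+1 + C / 2 ^+ n.
  by rewrite /e exprS; field; rewrite expf_neq0.
have e0 n : 0 <= e n by rewrite /e divr_ge0 ?mulr_ge0 ?exprn_ge0.
have vS n : u n - e n <= u n.+1 - e n.+1.
  by move: (uC n); rewrite ler_norml => /andP[+ _]; rewrite (eS n); lra.
have wS n : u n.+1 + e n.+1 <= u n + e n.
  by move: (uC n); rewrite ler_norml => /andP[_ +]; rewrite (eS n); lra.
have vM : {homo (fun n => u n - e n) : m n / (m <= n)%N >-> m <= n}.
  by apply: homo_leq vS => // ? ? ?; exact: le_trans.
have wM : {homo (fun n => u n + e n) : m n / (m <= n)%N >-> n <= m}.
  apply: (@homo_leq _ _ (fun x y => y <= x)) wS => // y x z xy yz.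
  exact: le_trans yz xy.
(* Both ends are compared at the index [maxn m n], by monotonicity. *)
have vw m n : u m - e m <= u n + e n.
  apply: (le_trans (vM _ _ (leq_maxl m n))).
  apply: le_trans (wM _ _ (leq_maxr m n)).
  by move: (e0 (maxn m n)); lra.
pose S := range (fun n => u n - e n).
have hS : has_sup S.
  split; first by exists (u 0 - e 0), 0.
  by exists (u 0 + e 0) => _ [n _ <-]; exact: vw.
exists (sup S) => n; rewrite ler_norml; apply/andP; split.
  suff : u n - e n <= sup S by rewrite -/(e n); lra.
  by apply: ub_le_sup; [case: hS|exists n].
suff : sup S <= u n + e n by rewrite -/(e n); lra.
by apply: ge_sup; [case: hS|move=> _ [m _ <-]; exact: vw].
Qed.

(** * Lipschitz functions and integrals of continuous functions over intervals *)

Section lipschitz_integrals.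
Context {R : realType}.
Notation mu := (@lebesgue_measure R).
Implicit Types f g : R -> R.

Lemma lipschitz_continuous (K : R) f :
  (forall s t, `|f s - f t| <= K * `|s - t|) -> continuous f.
Proof.
move=> fK x; apply/cvgrPdist_lt => e e0.
(* The sign of [K] is not known; [|K| + 1] is positive in every case. *)
have K1 : 0 < `|K| + 1 by rewrite ltr_wpDl.
near=> y.
have xy : `|x - y| < e / (`|K| + 1).
  by near: y; apply: cvgr_dist_lt; rewrite ?divr_gt0.
apply: (le_lt_trans (fK _ _)).
move: xy; rewrite ltr_pdivlMr// => xy.
apply: le_lt_trans xy.
rewrite mulrC ler_wpM2l//.
by rewrite (le_trans (ler_norm K))// lerDl.
Unshelve. all: by end_near. Qed.

Lemma continuous_itv_integrable f (a b : R) : continuous f ->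
  mu.-integrable `[a, b] (EFin \o f).
Proof.
move=> cf; apply: continuous_compact_integrable; first exact: segment_compact.
exact: continuous_subspaceT.
Qed.

Lemma Rintegral_itv_norm_le f (a b M : R) : continuous f -> a <= b ->
  (forall s, `|f s| <= M) -> `|\int[mu]_(s in `[a, b]) f s| <= M * (b - a).
Proof.
move=> cf ab fM.
apply: le_trans (le_normr_Rintegral _ (continuous_itv_integrable _ _ _ cf)) _ => //.
have cn : continuous (fun s => `|f s|).
  by move=> x; apply: continuous_comp; [exact: cf|exact: norm_continuous].
apply: (@le_trans _ _ (\int[mu]_(s in `[a, b]) M)).
  apply: le_Rintegral => //.
  - exact: (@continuous_itv_integrable (fun s => `|f s|)).
  - by apply: (@continuous_itv_integrable (fun s => M)) => x; exact: cvg_cst.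
rewrite Rintegral_cst//= lebesgue_measure_itv/= lte_fin.
by move: ab; rewrite le_eqVlt => /predU1P[->|->]; rewrite ?subrr ?ltxx.
Qed.

Lemma continuous_ocitv_integrable f (a b : R) : continuous f ->
  mu.-integrable `]a, b] (EFin \o f).
Proof.
move=> cf; apply: integrableS (continuous_itv_integrable _ a b cf) => //.
by move=> x /=; rewrite !in_itv/= => /andP[/ltW -> ->].
Qed.

Lemma EFin_Rintegral_ocitv f (a b : R) : continuous f ->
  ((\int[mu]_(s in `]a, b]) f s)%:E = \int[mu]_(s in `]a, b]) (f s)%:E)%E.
Proof.
move=> cf; rewrite /Rintegral fineK//; apply: integrable_fin_num => //.
exact: continuous_ocitv_integrable.
Qed.

Lemma Rintegral_ocitv_norm_le f (a b M : R) : continuous f -> a <= b ->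
  (forall s, `|f s| <= M) -> `|\int[mu]_(s in `]a, b]) f s| <= M * (b - a).
Proof.
move=> cf ab fM; rewrite Rintegral_itv_obnd_cbnd ?Rintegral_itv_norm_le//.
exact: continuous_ocitv_integrable.
Qed.

Lemma Rintegral_itv_sub f (t0 s t : R) : continuous f -> t0 <= s -> s <= t ->
  \int[mu]_(r in `[t0, t]) f r - \int[mu]_(r in `[t0, s]) f r =
  \int[mu]_(r in `]s, t]) f r.
Proof.
by move=> cf t0s st; apply: Rintegral_itvB; rewrite ?bnd_simp//;
   exact: continuous_itv_integrable.
Qed.

(* Between the last time [s] at which [f] is nonnegative and [t], the
   integrand [g] is nonnegative. *)
Lemma quasipositive_integral_ge0 (K f0 t0 t1 : R) f g :
    (forall s t, `|f s - f t| <= K * `|s - t|) -> continuous g ->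
    (forall t, t0 <= t <= t1 -> f t = f0 + \int[mu]_(s in `[t0, t]) g s) ->
    0 <= f0 -> (forall s, f s <= 0 -> 0 <= g s) ->
  forall t, t0 <= t <= t1 -> 0 <= f t.
Proof.
move=> fK cg fE f00 fg t /andP[t0t tt1]; rewrite leNgt; apply/negP => ft0.
pose S := [set s | t0 <= s <= t /\ 0 <= f s].
have St0 : S t0.
  split; first by rewrite lexx.
  by rewrite fE ?lexx ?(le_trans t0t)// set_itv1 Rintegral_set1 addr0.
have hS : has_sup S by split; [exists t0|exists t => s [/andP[]]].
set s := sup S.
have t0s : t0 <= s by apply: ub_le_sup => //; case: hS.
have st : s <= t by apply: ge_sup => [|r [/andP[]]//]; exists t0.
have K0 : 0 <= K.
  by have := le_trans (normr_ge0 _) (fK 1 0); rewrite subr0 normr1 mulr1.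
(* If [f s] were negative, the Lipschitz bound would keep [f] negative within [- f s / (K + 1)] to
   the left of [s], where the supremum has points of [S]. *)
have fs : 0 <= f s.
  rewrite leNgt; apply/negP => fs0.
  have K1 : 0 < K + 1 by lra.
  have e0 : 0 < - f s / (K + 1) by rewrite divr_gt0// oppr_gt0.
  have [r [rt fr] rs] := sup_adherent e0 hS.
  have rles : r <= s by apply: ub_le_sup => //; case: hS.
  have := fK r s; rewrite [`|r - s|]distrC [`|s - r|]ger0_norm ?subr_ge0//.
  move=> /(le_trans (ler_norm _)) h.
  have h2 : s - r < - f s / (K + 1) by rewrite -/s in rs; lra.
  move: h2; rewrite ltr_pdivlMr// => h2.
  have : 0 <= s - r by lra.
  nra.
have : 0 <= f t - f s.
  rewrite (fE t) ?t0t// (fE s) ?t0s ?(le_trans st)//.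
  rewrite opprD addrACA subrr add0r Rintegral_itv_sub//.
  apply: Rintegral_ge0 => r /=; rewrite in_itv/= => /andP[sr rt].
  (* A point [r] of []s, t]] with [f r > 0] would belong to [S] and exceed its supremum. *)
  apply: fg; rewrite leNgt; apply/negP => fr.
  have : r <= s.
    apply: ub_le_sup; first by case: hS.
    by split; [rewrite rt andbT (le_trans t0s)// ltW|exact: ltW].
  by rewrite leNgt sr.
lra.
Qed.

End lipschitz_integrals.

(** * Picard iteration for a bounded Lipschitz field *)

Section picard.
Context {R : realType}.
Notation mu := (@lebesgue_measure R).
Variables (G : (nat -> R) -> nat -> R) (K L : R) (x0 : nat -> R) (t0 d : R).
Hypothesis G_bounded : forall x j, `|G x j| <= K.
Hypothesis L_ge0 : 0 <= L.
Hypothesis G_lipschitz : forall x y e, 0 <= e -> (forall j, `|x j - y j| <= e) ->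
  forall j, `|G x j - G y j| <= L * e.
Hypothesis d_ge0 : 0 <= d.
Hypothesis Ld : L * d <= 2^-1.

(** Clamping the time makes every iterate Lipschitz on the whole line, so that no estimate has to be
    restricted to [[t0, t0 + d]]. *)
Let clamp (t : R) := Num.max t0 (Num.min (t0 + d) t).

Let clamp_ge t : t0 <= clamp t. Proof. by rewrite le_max lexx. Qed.

Let clamp_le t : clamp t <= t0 + d.
Proof. by rewrite ge_max lerDl d_ge0 ge_min lexx. Qed.

Let clampK t : t0 <= t <= t0 + d -> clamp t = t.
Proof. by case/andP=> h1 h2; rewrite /clamp min_r// max_r. Qed.

Let clamp_low t : t <= t0 -> clamp t = t0.
Proof. by move=> h; rewrite /clamp max_l// ge_min h orbT. Qed.

Let clamp_dist s t : `|clamp s - clamp t| <= `|s - t|.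
Proof. exact: clamp_nonexpansive. Qed.

Let K_ge0 : 0 <= K. Proof. exact: le_trans (normr_ge0 _) (G_bounded x0 0). Qed.

(** This class is stable under [Phi], and on it the integrand is continuous, hence integrable on
    compact intervals. *)
Let slow (y : R -> nat -> R) := forall s t j, `|y s j - y t j| <= K * `|s - t|.

Let Phi (y : R -> nat -> R) (t : R) (j : nat) :=
  x0 j + \int[mu]_(s in `[t0, clamp t]) G (y s) j.

Let G_continuous y j : slow y -> continuous (fun s => G (y s) j).
Proof.
move=> sy; apply: (@lipschitz_continuous _ (L * K)) => s t.
by rewrite -mulrA; apply: G_lipschitz => //; rewrite mulr_ge0.
Qed.

Let Phi_slow y : slow y -> slow (Phi y).
Proof.
move=> sy s t j.
wlog st : s t / clamp s <= clamp t => [wl|].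
  have [/wl//|/ltW/wl] := leP (clamp s) (clamp t).
  by rewrite distrC [in X in _ <= X]distrC.
rewrite distrC /Phi opprD addrACA subrr add0r.
rewrite Rintegral_itv_sub//; last exact: G_continuous.
apply: le_trans (Rintegral_ocitv_norm_le _ _ _ K (G_continuous _ j sy) st _) _.
  by move=> r; exact: G_bounded.
rewrite ler_wpM2l// -(@ger0_norm _ (clamp t - clamp s)) ?subr_ge0//.
by rewrite distrC.
Qed.

(** The integrands differ by at most [L * e] on an interval of length at most [d], and [L * d] is at
    most 1/2. *)
Let Phi_contraction y z e : slow y -> slow z -> 0 <= e ->
  (forall t j, `|y t j - z t j| <= e) ->
  forall t j, `|Phi y t j - Phi z t j| <= e / 2.
Proof.
move=> sy sz e0 yze t j.
rewrite /Phi opprD addrACA subrr add0r -RintegralB//; last 2 first.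
  by apply: continuous_itv_integrable; exact: G_continuous.
  by apply: continuous_itv_integrable; exact: G_continuous.
apply: le_trans.
  apply: (@Rintegral_itv_norm_le _ _ _ _ (L * e)) => //.
    by move=> s; apply: cvgB; exact: G_continuous.
  by move=> s; exact: G_lipschitz.
have : clamp t - t0 <= d by rewrite lerBlDl.
have := clamp_ge t; rewrite -subr_ge0.
move: (clamp t - t0) => u u0 ud.
rewrite mulrAC mulrC ler_wpM2l//.
by apply: le_trans Ld; rewrite ler_wpM2l.
Qed.

Let u n := iter n Phi (fun=> x0).

Let u_slow n : slow (u n).
Proof.
elim: n => [s t j|n ih]; last exact: Phi_slow.
by rewrite subrr normr0 mulr_ge0.
Qed.

(** The first increment integrates a field bounded by [K] over a length at most [d]; the contraction
    halves each later one. *)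
Let u_step n t j : `|u n.+1 t j - u n t j| <= K * d / 2 ^+ n.
Proof.
have Kd : 0 <= K * d by rewrite mulr_ge0.
elim: n t j => [|n ih] t j.
  rewrite /u/= /Phi [x0 j + _]addrC addrK expr0 divr1.
  apply: le_trans (Rintegral_itv_norm_le _ _ _ K _ (clamp_ge t) _) _ => //.
  - by apply: (G_continuous (fun=> x0)) => ? ? ?; rewrite subrr normr0 mulr_ge0.
  - by rewrite ler_wpM2l// lerBlDl.
rewrite exprSr invfM mulrA.
apply: (Phi_contraction (u n.+1) (u n)) => //.
by rewrite divr_ge0// exprn_ge0.
Qed.

(** The iterates converge geometrically, at a rate uniform in time and component, so the Lipschitz
    bound and the fixed point equation both pass to the limit. *)
Lemma picard_existence : exists y : R -> nat -> R,
  (forall s t j, `|y s j - y t j| <= K * `|s - t|) /\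
  (forall t j, t <= t0 -> y t j = x0 j) /\
  (forall t j, t0 <= t <= t0 + d ->
    y t j = x0 j + \int[mu]_(s in `[t0, t]) G (y s) j).
Proof.
have lim t j : exists l, forall n, `|l - u n t j| <= 2 * (K * d) / 2 ^+ n.
  by apply: (geometric_limit _ (K * d)) => n; exact: u_step.
have [y0 yu] := choice (fun tj : R * nat => lim tj.1 tj.2).
pose y t j := y0 (t, j).
have {}yu n t j : `|y t j - u n t j| <= 2 * (K * d) / 2 ^+ n := yu (t, j) n.
(* The Archimedean property together with [N < 2 ^ N] makes the geometric bound smaller than any
   positive [e]. *)
have geo0 (c : R) : 0 <= c -> (forall n, c <= 2 * (2 * (K * d)) / 2 ^+ n) -> c = 0.
  move=> c0 h; apply/eqP; rewrite eq_le c0 andbT; apply/ler_addgt0Pl => e e0.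
  rewrite addr0.
  pose C := 2 * (2 * (K * d)).
  have C0 : 0 <= C by rewrite /C !mulr_ge0.
  have Ce : 0 <= C / e by rewrite divr_ge0// ltW.
  have := archi_boundP Ce; set N := Num.bound _ => CN.
  apply: le_trans (h N) _; rewrite -/C.
  rewrite ler_pdivrMr ?exprn_gt0// mulrC -ler_pdivrMr//.
  by apply: (le_trans (ltW CN)); rewrite -natrX ler_nat ltnW// ltn_expl.
have ys : slow y.
  move=> s t j; rewrite -subr_le0; set c := _ - _.
  (* [c] may be negative, so [geo0] is applied to its positive part. *)
  suff : Num.max 0 c = 0 by move=> <-; rewrite le_max lexx orbT.
  apply: geo0 => [|n]; first by rewrite le_max lexx.
  rewrite ge_max; apply/andP; split.
    by rewrite divr_ge0 ?exprn_ge0// !mulr_ge0.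
  have := u_slow n s t j; have := yu n s j; have := yu n t j.
  rewrite /c; set e := 2 * (K * d) / 2 ^+ n => h1 h2 h3.
  have -> : 2 * (2 * (K * d)) / 2 ^+ n = 2 * e by rewrite /e -!mulrA.
  rewrite distrC in h1.
  have := ler_distD (u n s j) (y s j) (y t j).
  have := ler_distD (u n t j) (u n s j) (y t j).
  by lra.
have yPhi t j : y t j = Phi y t j.
  apply/eqP; rewrite -subr_eq0 -normr_eq0; apply/eqP; apply: geo0 => // n.
  pose e := 2 * (K * d) / 2 ^+ n.
  have -> : 2 * (2 * (K * d)) / 2 ^+ n = 2 * e by rewrite /e -!mulrA.
  have e0 : 0 <= e by rewrite divr_ge0 ?exprn_ge0// !mulr_ge0.
  (* [u n.+1] is [Phi (u n)], hence close to both sides: to [y] by convergence, to [Phi y] by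
     contraction. *)
  have h1 : `|y t j - u n.+1 t j| <= e.
    apply: le_trans (yu _ _ _) _; rewrite /e exprS invfM mulrCA.
    by rewrite ler_piMl// invf_le1 ?ler1n.
  have h2 : `|Phi (u n) t j - Phi y t j| <= e / 2.
    by apply: Phi_contraction => // s i; rewrite distrC; exact: yu.
  have := ler_distD (u n.+1 t j) (y t j) (Phi y t j).
  by rewrite /u/= -/(u n) in h1 *; lra.
exists y; split => //; split => t j tt.
  by rewrite yPhi /Phi clamp_low// set_itv1 Rintegral_set1 addr0.
by rewrite yPhi /Phi clampK.
Qed.

End picard.

(** * The truncated quadratic field and its clamped version *)

(** On states vanishing beyond [p] this is the full right-hand side of the system, because the terms
    with index [k] carry the factor [x k]. *)
Definition rbk_trunc {R : realType} (a : nat -> nat -> R) (p : nat)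
    (x : nat -> R) (j : nat) : R :=
  \sum_(1 <= k < p.+1)
    (a (j + k)%N k * (x (j + k)%N * x k) - a j k * (x j * x k)).

Section clamped_field.
Context {R : realType}.
Variables (b : nat -> nat -> R) (p : nat) (A M : R).
Hypothesis b_le : forall j k, `|b j k| <= A.
Hypothesis M_ge0 : 0 <= M.

Let q (x : R) := Num.max 0 (Num.min M x).

Let q_ge0 x : 0 <= q x. Proof. by rewrite le_max lexx. Qed.

Let q_le x : q x <= M. Proof. by rewrite ge_max M_ge0 ge_min lexx. Qed.

Let q_lipschitz x y : `|q x - q y| <= `|x - y|.
Proof. exact: clamp_nonexpansive. Qed.

Let A_ge0 : 0 <= A. Proof. exact: le_trans (normr_ge0 _) (b_le 0 0). Qed.

Definition rbk_clamped (x : nat -> R) (j : nat) : R := rbk_trunc b p (q \o x) j.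

(** Each of the [p] summands is a difference of two terms of size at most [A * M ^+ 2]. *)
Lemma rbk_clamped_bounded x j : `|rbk_clamped x j| <= p%:R * (2 * A * M ^+ 2).
Proof.
apply: (le_trans (ler_norm_sum _ _ _)).
have -> : p%:R * (2 * A * M ^+ 2) = \sum_(1 <= k < p.+1) (2 * A * M ^+ 2).
  by rewrite sumr_const_nat subn1/= mulr_natl.
have qq u v : `|q u * q v| <= M ^+ 2.
  by rewrite ger0_norm ?mulr_ge0// expr2 ler_pM.
have h i k u v : `|b i k * (q u * q v)| <= A * M ^+ 2.
  by rewrite normrM ler_pM.
apply: ler_sum => k _; apply: (le_trans (ler_normB _ _)).
by apply: (le_trans (lerD (h _ _ _ _) (h _ _ _ _))); lra.
Qed.

(** Changing the two factors of a product one at a time costs [2 * M * e]; each summand contains two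
    such products, with coefficients at most [A] in absolute value. *)
Lemma rbk_clamped_lipschitz x y e : 0 <= e -> (forall j, `|x j - y j| <= e) ->
  forall j, `|rbk_clamped x j - rbk_clamped y j| <= p%:R * (4 * A * M) * e.
Proof.
move=> e0 xye j.
have -> : p%:R * (4 * A * M) * e = \sum_(1 <= k < p.+1) (4 * A * M * e).
  by rewrite sumr_const_nat subn1/= -mulrA mulr_natl.
rewrite /rbk_clamped /rbk_trunc -sumrB; apply: (le_trans (ler_norm_sum _ _ _)).
have h i k m n : `|b i k * (q (x m) * q (x n)) - b i k * (q (y m) * q (y n))|
    <= A * (2 * M * e).
  rewrite -mulrBr normrM ler_pM//.
  have -> : q (x m) * q (x n) - q (y m) * q (y n) =
    (q (x m) - q (y m)) * q (x n) + q (y m) * (q (x n) - q (y n)) by ring.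
  have -> : 2 * M * e = e * M + M * e by ring.
  apply: (le_trans (ler_normD _ _)); rewrite !normrM.
  apply: lerD; apply: ler_pM => //.
  - exact: le_trans (q_lipschitz _ _) (xye m).
  - by rewrite ger0_norm.
  - by rewrite ger0_norm.
  - exact: le_trans (q_lipschitz _ _) (xye n).
apply: ler_sum => k _ /=.
rewrite [X in `|X|](_ : _ =
  (b (j + k)%N k * (q (x (j + k)%N) * q (x k)) -
   b (j + k)%N k * (q (y (j + k)%N) * q (y k))) -
  (b j k * (q (x j) * q (x k)) - b j k * (q (y j) * q (y k)))); last by ring.
apply: (le_trans (ler_normB _ _)).
by apply: (le_trans (lerD (h _ _ _ _) (h _ _ _ _))); lra.
Qed.

(** The clamped value of [x j] is 0: the loss carries this factor and vanishes, while the gain is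
    nonnegative. *)
Lemma rbk_clamped_quasipositive x j :
    (forall k, (0 < k)%N -> 0 <= b (j + k)%N k) -> x j <= 0 ->
  0 <= rbk_clamped x j.
Proof.
move=> b0 xj; rewrite /rbk_clamped /rbk_trunc big_nat_cond.
apply: sumr_ge0 => k /=; rewrite andbT => /andP[k0 _].
have -> : q (x j) = 0.
  by rewrite /q max_l// ge_min xj orbT.
by rewrite mul0r mulr0 subr0 mulr_ge0 ?b0// mulr_ge0.
Qed.

Lemma rbk_clampedE x j :
    (forall i, (0 < i)%N -> 0 <= x i <= M) -> (0 < j)%N ->
  rbk_clamped x j = rbk_trunc b p x j.
Proof.
move=> x0 j0; have qE i : (0 < i)%N -> q (x i) = x i.
  by move=> /x0 /andP[h1 h2]; rewrite /q min_r// max_r.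
rewrite /rbk_clamped /rbk_trunc big_nat_cond [RHS]big_nat_cond.
by apply: eq_bigr => k /=; rewrite andbT => /andP[k0 _];
  rewrite !qE// addn_gt0 j0.
Qed.

End clamped_field.

(** * Local existence for the truncated system *)

Section local_existence.
Context {R : realType}.
Notation mu := (@lebesgue_measure R).

Lemma continuous_sum_nat (F : nat -> R -> R) m n :
  (forall k, continuous (F k)) ->
  continuous (fun t => \sum_(m <= k < n) F k t).
Proof.
move=> cF; elim: (index_iota _ _) => [|k r ih] t.
  by under eq_fun do rewrite big_nil; exact: cvg_cst.
under eq_fun do rewrite big_cons.
by apply: (@continuousD _ _ _ (F k)); [exact: cF|exact: ih].
Qed.

Lemma continuous_rbk_trunc (a : nat -> nat -> R) p (y : R -> nat -> R) j :
  (forall i, continuous (fun t => y t i)) ->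
  continuous (fun t => rbk_trunc a p (y t) j).
Proof.
move=> cy; apply: continuous_sum_nat => k t.
apply: (@continuousB _ _ _ (fun t => a (j + k)%N k * (y t (j + k)%N * y t k))).
  apply: (@continuousM _ _ (fun=> a (j + k)%N k)); first exact: cvg_cst.
  by apply: (@continuousM _ _ (y^~ (j + k)%N)); exact: cy.
apply: (@continuousM _ _ (fun=> a j k)); first exact: cvg_cst.
by apply: (@continuousM _ _ (y^~ j)); exact: cy.
Qed.

(* The step [d] depends on the initial state only through the bound [B], which
   is what allows the solution to be continued up to any time. *)
Lemma rbk_trunc_local_existence (a : nat -> nat -> R) (p : nat) (B : R) :
    (forall j k, (0 < j)%N -> (0 < k)%N -> 0 <= a j k) -> 0 <= B ->
  exists2 d : R, 0 < d & forall (t0 : R) (x0 : nat -> R),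
    (forall j, (0 < j)%N -> 0 <= x0 j <= B) ->
    (forall j, (p < j)%N -> x0 j = 0) ->
  exists y : R -> nat -> R, [/\ forall j, continuous (fun t => y t j),
    forall t, t <= t0 -> y t = x0,
    forall t j, t0 <= t <= t0 + d -> (0 < j)%N -> 0 <= y t j <= B + 1,
    forall t j, t <= t0 + d -> (p < j)%N -> y t j = 0 &
    forall t j, t0 <= t <= t0 + d -> (0 < j)%N ->
      y t j = x0 j + \int[mu]_(s in `[t0, t]) rbk_trunc a p (y s) j].
Proof.
move=> a0 B0.
(* Cutting the rates off beyond [p] bounds them and makes the field vanish in every component beyond
   [p]. Wherever this changes a rate, the solution supplies a zero factor. *)
pose b j k : R := if (j <= p)%N && (k <= p)%N then a j k else 0.
(* The absolute values also cover index 0, where the sign of [a] is not known. *)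
pose A : R := \sum_(i < p.+1) \sum_(k < p.+1) `|a i k|.
have A0 : 0 <= A by apply: sumr_ge0 => i _; apply: sumr_ge0.
have bA j k : `|b j k| <= A.
  rewrite /b; case: ifPn => [/andP[jp kp]|_]; last by rewrite normr0.
  rewrite /A (bigD1 (inord j))//= (bigD1 (inord k))//= !inordK//.
  rewrite -addrA lerDl addr_ge0//; apply: sumr_ge0 => // i _.
  exact: sumr_ge0.
(* The margin 1 is what a component can gain during one step, since [K * d <= 1]; the solution
   therefore stays below the clamping level. *)
pose M : R := B + 1.
have M0 : 0 <= M by rewrite addr_ge0.
pose K : R := p%:R * (2 * A * M ^+ 2).
pose L : R := p%:R * (4 * A * M).
have K0 : 0 <= K by rewrite !mulr_ge0 ?exprn_ge0.
have L0 : 0 <= L by rewrite !mulr_ge0.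
(* One choice gives both [K * d <= 1] and [L * d <= 2^-1]; the summand 1 keeps the denominator
   positive. *)
pose d : R := (2 * (K + L + 1))^-1.
have D0 : 0 < 2 * (K + L + 1) by lra.
have d0 : 0 < d by rewrite invr_gt0.
have Ld : L * d <= 2^-1.
  by rewrite /d ler_pdivrMr//; lra.
have Kd : K * d <= 1.
  by rewrite /d ler_pdivrMr//; lra.
exists d => // t0 x0 x0B x0p.
have [y [ylip [ylow yE]]] := @picard_existence R (rbk_clamped b p M) K L x0 t0 d
  (rbk_clamped_bounded b p A M bA M0) L0 (rbk_clamped_lipschitz b p A M bA M0) (ltW d0) Ld.
have cy j : continuous (fun t => y t j).
  by apply: (lipschitz_continuous K) => s t; exact: ylip.
have cG j : continuous (fun s => rbk_clamped b p M (y s) j).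
  apply: (lipschitz_continuous (L * K)) => s t; rewrite -mulrA.
  by apply: rbk_clamped_lipschitz => //; rewrite mulr_ge0.
have ypos t j : t0 <= t <= t0 + d -> (0 < j)%N -> 0 <= y t j.
  move=> tt j0.
  apply: (@quasipositive_integral_ge0 R K (x0 j) t0 (t0 + d) (fun t => y t j)
    (fun s => rbk_clamped b p M (y s) j)) => //.
  - by move=> s ts; exact: yE.
  - by have /andP[] := x0B j j0.
  - move=> s; apply: rbk_clamped_quasipositive => k k0; rewrite /b.
    by case: ifP => // _; rewrite a0// addn_gt0 j0.
have yp t j : t <= t0 + d -> (p < j)%N -> y t j = 0.
  move=> tt pj; have [tt0|t0t] := leP t t0; first by rewrite ylow// x0p.
  rewrite yE ?(ltW t0t)// x0p// add0r.
  under eq_Rintegral => s _.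
    rewrite /rbk_clamped /rbk_trunc big1 => [|k _]; last first.
      rewrite /b [(j + k <= p)%N]leqNgt [(j <= p)%N]leqNgt pj ltn_addr//=.
      by rewrite !mul0r subr0.
    over.
  by rewrite Rintegral_cst// mul0r.
have yB t j : t0 <= t <= t0 + d -> (0 < j)%N -> 0 <= y t j <= M.
  move=> tt j0; rewrite ypos//=.
  have := ylip t t0 j; rewrite (ylow t0)//; have /andP[_ xB] := x0B j j0.
  case/andP: tt => h1 h2; rewrite (ger0_norm (_ : 0 <= t - t0)) ?subr_ge0//.
  have : K * (t - t0) <= K * d by rewrite ler_wpM2l// lerBlDl.
  by have := ler_norm (y t j - x0 j); rewrite /M; lra.
exists y; split => //.
  by move=> t tt0; apply/funext => j; exact: ylow.
move=> t j tt j0; rewrite yE//; congr (_ + _).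
apply: eq_Rintegral => s; rewrite inE/= in_itv/= => /andP[h1 h2].
have ss : t0 <= s <= t0 + d by rewrite h1 (le_trans h2)//; case/andP: tt.
(* The components stay in [[0, M]] here, so the clamping has no effect; it remains to replace [b] by
   [a]. *)
rewrite rbk_clampedE//; last by move=> i i0; exact: yB.
rewrite /rbk_trunc big_nat_cond [RHS]big_nat_cond.
apply: eq_bigr => k /=; rewrite andbT => /andP[k0 kp].
rewrite ltnS in kp; rewrite /b kp !andbT; congr (_ - _).
  case: leqP => // pjk; rewrite [y s (j + k)%N]yp//; last by case/andP: ss.
  by rewrite !mul0r mulr0.
case: leqP => // pj; rewrite [y s j]yp//; last by case/andP: ss.
by rewrite !mul0r mulr0.
Qed.

End local_existence.

(** * Series over states of finite support *)

Section finite_support.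
Context {R : realType}.

Lemma eseries_finite_support (f : nat -> \bar R) m p :
  (forall k, (p <= k)%N -> f k = 0%E) ->
  (\sum_(m <= k <oo) f k = \sum_(m <= k < p) f k)%E.
Proof.
move=> f0; apply: lim_near_cst => //.
near=> n.
have pn : (p <= n)%N by near: n; exact: nbhs_infty_ge.
have [mp|pm] := leqP m p; last first.
  (* For [p < m] the right-hand sum is empty and every term on the left vanishes. *)
  rewrite [RHS]big_geq 1?ltnW// big_nat_cond big1// => k.
  by rewrite andbT => /andP[mk _]; rewrite f0// (leq_trans (ltnW pm)).
rewrite (big_cat_nat mp pn)/= [X in (_ + X)%E]big_nat_cond.
rewrite [X in (_ + X)%E]big1 ?adde0// => k.
by rewrite andbT => /andP[pk _]; rewrite f0.
Unshelve. all: by end_near. Qed.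

Variables (a : nat -> nat -> R) (p : nat) (x : nat -> R).
Hypothesis x0 : forall j, (p < j)%N -> x j = 0.

Lemma norm1_finite_support :
  norm1 x = (\sum_(1 <= j < p.+1) j%:R * `|x j|)%:E.
Proof.
rewrite /norm1 (eseries_finite_support _ _ p.+1) ?sumEFin// => k pk.
by rewrite x0// normr0 mulr0.
Qed.

Lemma rbk_gainE_finite_support j : rbk_gain a x j =
  (\sum_(1 <= k < p.+1) a (j + k)%N k * x (j + k)%N * x k)%:E.
Proof.
rewrite /rbk_gain (eseries_finite_support _ _ p.+1) ?sumEFin// => k pk.
by rewrite (x0 k)// mulr0.
Qed.

Lemma rbk_lossE_finite_support j : rbk_loss a x j =
  (\sum_(1 <= k < p.+1) a j k * x j * x k)%:E.
Proof.
rewrite /rbk_loss (eseries_finite_support _ _ p.+1) ?sumEFin// => k pk.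
by rewrite (x0 k)// mulr0.
Qed.

(** Both series are finite sums of reals, so the difference in [\bar R] is the real one. *)
Lemma rbk_rhs_finite_support j :
  (rbk_gain a x j - rbk_loss a x j)%E = (rbk_trunc a p x j)%:E.
Proof.
rewrite rbk_gainE_finite_support rbk_lossE_finite_support -EFinB -sumrB.
by congr EFin; apply: eq_bigr => k _; rewrite !mulrA.
Qed.

End finite_support.

(** * Measurability in time of the series under the integrals *)

Section measurability.
Context {R : realType}.

Lemma measurable_fun_series1 (D : set R) (f : nat -> R -> R) :
    (forall k, (0 < k)%N -> measurable_fun D (f k)) ->
    (forall k s, (0 < k)%N -> D s -> 0 <= f k s) ->
  measurable_fun D (fun s => \sum_(1 <= k <oo) (f k s)%:E)%E.
Proof.
move=> mf f0.
(* Moving the lower bound of the range into a predicate excludes index 0, about which nothing is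
   assumed. *)
under eq_fun do rewrite eseries_cond/=.
apply: (ge0_emeasurable_sum (h := fun k s => (f k s)%:E)
  (P := fun k => 0 < k)%N) => [k s Ds k0|k k0].
  by rewrite lee_fin f0.
by apply/measurable_EFinP; exact: mf.
Qed.

Variables (a : nat -> nat -> R) (D : set R) (z : R -> nat -> R).
Hypothesis a_ge0 : forall j k, (0 < j)%N -> (0 < k)%N -> 0 <= a j k.
Hypothesis mz : forall j, (0 < j)%N -> measurable_fun D (fun t => z t j).
Hypothesis z_ge0 : forall j t, (0 < j)%N -> D t -> 0 <= z t j.

Lemma measurable_rate j : (0 < j)%N ->
  measurable_fun D (fun s => \sum_(1 <= k <oo) (a j k * z s k)%:E)%E.
Proof.
move=> j0; apply: measurable_fun_series1 => [k k0|k s k0 Ds].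
  by apply: measurable_funM => //; exact: mz.
by rewrite mulr_ge0 ?a_ge0 ?z_ge0.
Qed.

Lemma measurable_rbk_rhs j : (0 < j)%N ->
  measurable_fun D (fun s => rbk_gain a (z s) j - rbk_loss a (z s) j)%E.
Proof.
move=> j0; apply: emeasurable_funB; apply: measurable_fun_series1.
- move=> k k0; apply: measurable_funM; last exact: mz.
  by apply: measurable_funM => //; apply: mz; rewrite addn_gt0 j0.
- by move=> k s k0 Ds; rewrite !mulr_ge0 ?a_ge0 ?z_ge0// addn_gt0 j0.
- move=> k k0; apply: measurable_funM; last exact: mz.
  by apply: measurable_funM => //; exact: mz.
- by move=> k s k0 Ds; rewrite !mulr_ge0 ?a_ge0 ?z_ge0.
Qed.

End measurability.

(** Meant for the map from [t] to [Num.min t t0], which freezes a solution after time [t0]. *)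
Lemma within_continuous_precomp {T U V : topologicalType} (D : set U)
    (D' : set T) (f : U -> V) (g : T -> U) :
    continuous g -> (forall s, D' s -> D (g s)) ->
    {within D, continuous f} ->
  {within D', continuous (f \o g)}.
Proof.
move=> cg gD /subspace_continuousP cf; apply/subspace_continuousP => t tD'.
apply: (cvg_comp g f _ (cf _ (gD _ tD'))) => P wP.
have := cg t _ wP; rewrite /= !nbhs_simpl/= /within/= => nP.
near=> s => sD'.
have : D (g s) -> P (g s) by near: s; exact: nP.
by apply; exact: gD.
Unshelve. all: by end_near. Qed.

(** * Restriction, bounds and gluing of solutions *)

Section solutions.
Context {R : realType}.
Notation mu := (@lebesgue_measure R).
Variable a : nat -> nat -> R.
Hypothesis a_ge0 : forall j k, (0 < j)%N -> (0 < k)%N -> 0 <= a j k.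

(** Uniqueness compares solutions on a common interval, and the glued solution may live on a shorter
    one than the original. *)
Lemma rbk_solution_restrict (T T' : \bar R) c0 c :
  rbk_solution a T c0 c -> (0 < T')%E -> (T' <= T)%E -> rbk_solution a T' c0 c.
Proof.
move=> [T0 h1 h2 h3 h4 h5 h6 h7] T'0 T'T.
have sub : time_dom T' `<=` time_dom T.
  by move=> t [t0 tT']; split => //; exact: lt_le_trans T'T.
split => //.
- by move=> t /sub; exact: h3.
- by move=> j j0; apply: continuous_subspaceW (h4 j j0).
- by apply: le_lt_trans h5; apply: ereal_sup_le; exact: image_subset.
- by move=> j t j0 /sub; exact: h6.
- by move=> j t j0 /sub; exact: h7.
Qed.

(** The weights in the norm are at least 1 and its terms are nonnegative. *)
Lemma le_norm1 (x : nat -> R) j : (0 < j)%N -> (`|x j|%:E <= norm1 x)%E.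
Proof.
move=> j0; apply: le_trans (nneseries_lim_ge j.+1 _) => /=; last first.
  by move=> n _ _; rewrite lee_fin mulr_ge0.
rewrite big_nat_recr//= -[leLHS]add0e; apply: leeD.
  by apply: sume_ge0 => n _; rewrite lee_fin mulr_ge0.
by rewrite lee_fin ler_peMl// ler1n.
Qed.

(** The bound is the supremum of the norms over time, so it serves all starting times at once. *)
Lemma rbk_solution_bounded (T : \bar R) c0 c : rbk_solution a T c0 c ->
  exists2 B, 0 <= B & forall t j, time_dom T t -> (0 < j)%N -> 0 <= c t j <= B.
Proof.
move=> sol; have [T0 _ _ cX _ + _ _] := sol.
set N := ereal_sup _ => Noo.
have dom0 : time_dom T 0 by split.
have N0 : (0 <= N)%E.
  apply: (@le_trans _ _ (norm1 (c 0))); last by apply: ereal_sup_ubound; exists 0.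
  by apply: nneseries_ge0 => n _ _; rewrite lee_fin mulr_ge0.
have Nfin : N \is a fin_num by rewrite ge0_fin_numE.
exists (fine N) => [|t j tT j0]; first exact: fine_ge0.
have [_ cpos] := cX t tT; rewrite cpos//= -lee_fin fineK//.
rewrite -[c t j]ger0_norm ?cpos//.
apply: le_trans (le_norm1 _ _ j0) _.
by apply: ereal_sup_ubound; exists t.
Qed.

(* Both integrals in the definition of a solution split at [t0]; only
   measurability is needed for that, not integrability. *)
Lemma rbk_solution_glue (T : \bar R) c0 c p t0 d B (y : R -> nat -> R) :
    rbk_solution a T c0 c -> time_dom T t0 -> 0 < d ->
    (forall j, continuous (fun t => y t j)) ->
    (forall t, t <= t0 -> y t = c t0) ->
    (forall t j, t0 <= t <= t0 + d -> (0 < j)%N -> 0 <= y t j <= B) ->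
    (forall t j, t <= t0 + d -> (p < j)%N -> y t j = 0) ->
    (forall t j, t0 <= t <= t0 + d -> (0 < j)%N ->
      y t j = c t0 j + \int[mu]_(s in `[t0, t]) rbk_trunc a p (y s) j) ->
  rbk_solution a (Order.min T (t0 + d)%:E) c0
    (fun t => if t <= t0 then c t else y t).
Proof.
move=> sol [t00 t0T] d0 cy ylow yB yp yE.
set T' := Order.min _ _; set z := fun t => _.
have [T0 c0X ci cX cc cb cint cE] := sol.
have T'0 : (0 < T')%E by rewrite /T' lt_min T0 lte_fin; lra.
have dom' t : time_dom T' t -> [/\ 0 <= t, time_dom T t & t <= t0 + d].
  by move=> [h1]; rewrite /T' lt_min lte_fin => /andP[h2 /ltW h3]; split.
have dom_le s t : time_dom T' t -> 0 <= s -> s <= t -> time_dom T' s.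
  by move=> [_ tT'] s0 st; split => //; apply: le_lt_trans tT'; rewrite lee_fin.
have zlow t : t <= t0 -> z t = c t by rewrite /z => ->.
have zhigh t : t0 < t -> z t = y t by rewrite /z leNgt => ->.
have zpos j t : (0 < j)%N -> time_dom T' t -> 0 <= z t j.
  move=> j0 /dom'[t_0 tT ttd]; have [tt0|t0t] := leP t t0.
    by rewrite zlow//; have [_] := cX t tT; apply.
  by rewrite zhigh//; have /(_ j0)/andP[] := yB t j (introT andP (conj (ltW t0t) ttd)).
(* Bounds the norm of [y], which has at most [p] nonzero components, each at most [B]. *)
pose S : R := \sum_(1 <= j < p.+1) j%:R * B.
have ynorm t : t0 <= t <= t0 + d -> (norm1 (y t) <= S%:E)%E.
  move=> tt; rewrite (norm1_finite_support p) => [|j]; last first.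
    by apply: yp; case/andP: tt.
  rewrite lee_fin /S big_nat_cond [leRHS]big_nat_cond; apply: ler_sum => j.
  rewrite andbT => /andP[j0 _]; rewrite ler_wpM2l//.
  by have /andP[y0 yB'] := yB t j tt j0; rewrite ger0_norm.
have zc j : (0 < j)%N -> {within time_dom T', continuous (fun t => z t j)}.
  (* Writing [z] as [c] frozen after [t0], plus an increment of [y] that vanishes up to [t0], avoids
     treating continuity at the junction separately. *)
  move=> j0; have -> : (fun t => z t j) =
      (fun t => c (Num.min t t0) j) \+ (fun t => y t j - c t0 j).
    apply/funext => t /=; have [tt0|t0t] := leP t t0.
      by rewrite zlow// ylow// subrr addr0.
    by rewrite zhigh// addrC subrK.
  move=> t; apply: (@continuousD _ _ (subspace (time_dom T'))
      (fun t : subspace (time_dom T') => c (Num.min t t0) j)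
      (fun t : subspace (time_dom T') => y t j - c t0 j)); last first.
    apply: continuous_subspaceT => s; apply: cvgB; last exact: cvg_cst.
    exact: cy.
  apply: (@within_continuous_precomp _ _ _ (time_dom T) (time_dom T') (c^~ j)
    (fun s => Num.min s t0)); last exact: cc.
    move=> s; apply: (@lipschitz_continuous _ 1) => u v; rewrite mul1r.
    (* The lower level is the smaller of the two values, so it is inactive and only the minimum with
       [t0] remains. *)
    have := clamp_nonexpansive (Num.min (Num.min u t0) (Num.min v t0)) t0 u v.
    by rewrite ![Num.min t0 _]minC !max_r// ge_min lexx ?orbT.
  move=> s /dom'[s0 [_ sT] _]; split; first by rewrite le_min s0.
  by have [] := leP s t0.
have zm j t : (0 < j)%N -> time_dom T' t ->
    measurable_fun `[0, t] (fun s => z s j).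
  move=> j0 tT'; apply: subspace_continuous_measurable_fun => //.
  apply: continuous_subspaceW (zc j j0) => s /=; rewrite in_itv/= => /andP[s0 st].
  exact: dom_le st.
have zpos' t : time_dom T' t -> forall j s, (0 < j)%N ->
    `[0, t]%classic s -> 0 <= z s j.
  move=> tT' j s j0 /=; rewrite in_itv/= => /andP[s0 st].
  by apply: zpos => //; exact: dom_le st.
have split_itv t (f : R -> \bar R) : t0 < t -> measurable_fun `[0, t] f ->
    (\int[mu]_(s in `[0%R, t]) f s =
     \int[mu]_(s in `[0%R, t0]) f s + \int[mu]_(s in `]t0, t]) f s)%E.
  move=> t0t; rewrite (@itv_bndbnd_setU _ _ _ (BRight t0)) ?bnd_simp// ?ltW// => mf.
  rewrite integral_setU// disj_set2E; apply/eqP/seteqP; split => // s /= [].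
  by rewrite !in_itv/= => /andP[_ st0] /andP[t0s _]; move: t0s; rewrite ltNge st0.
have t0dom : time_dom T t0 by [].
split => //.
- by move=> j j0; rewrite zlow// ci.
- move=> t tT'; split; last by move=> j j0; exact: zpos.
  have [_ tT ttd] := dom' t tT'; have [tt0|t0t] := leP t t0.
    by rewrite /X1/= zlow//; have [] := cX t tT.
  by rewrite /X1/= zhigh// (le_lt_trans (ynorm t _)) ?ltry// (ltW t0t).
- apply: (@le_lt_trans _ _ (Order.max
    (ereal_sup [set norm1 (c t) | t in time_dom T]) S%:E)); last first.
    by rewrite gt_max cb ltry.
  apply: ge_ereal_sup => _ [t /dom'[_ tT ttd] <-].
  rewrite le_max; have [tt0|t0t] := leP t t0.
    by rewrite zlow// ereal_sup_ubound//; exists t.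
  by rewrite zhigh// ynorm ?orbT// (ltW t0t).
- move=> j t j0 tT'; have [_ tT ttd] := dom' t tT'.
  have [tt0|t0t] := leP t t0.
    rewrite (eq_integral (mu := mu) (fun s => \sum_(1 <= k <oo) (a j k * c s k)%:E)%E).
      exact: cint.
    move=> s; rewrite inE/= in_itv/= => /andP[_ st].
    by rewrite zlow// (le_trans st).
  rewrite split_itv//; last first.
    by apply: measurable_rate => //; [move=> i i0; exact: zm|exact: zpos'].
  apply: lte_add_pinfty.
    rewrite (eq_integral (mu := mu) (fun s => \sum_(1 <= k <oo) (a j k * c s k)%:E)%E).
      exact: cint.
    by move=> s; rewrite inE/= in_itv/= => /andP[_ st]; rewrite zlow.
  (* After [t0] the series is a finite sum of continuous functions, whose integral is finite. *)
  rewrite (eq_integral (mu := mu) (fun s => (\sum_(1 <= k < p.+1) a j k * y s k)%:E)).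
    rewrite -EFin_Rintegral_ocitv ?ltry//.
    apply: continuous_sum_nat => k s.
    by apply: (@continuousM _ _ (fun=> a j k)); [exact: cvg_cst|exact: cy].
  move=> s; rewrite inE/= in_itv/= => /andP[t0s st].
  rewrite zhigh// (eseries_finite_support _ _ p.+1) ?sumEFin// => k pk.
  by rewrite yp ?mulr0// (le_trans st).
- move=> j t j0 tT'; have [_ tT ttd] := dom' t tT'.
  have [tt0|t0t] := leP t t0.
    rewrite zlow// cE//; congr (_ + _)%E; apply: eq_integral => s.
    rewrite inE/= in_itv/= => /andP[_ st].
    by rewrite zlow// (le_trans st).
  have cG := continuous_rbk_trunc a p y j cy.
  rewrite split_itv//; last first.
    by apply: measurable_rbk_rhs => //; [move=> i i0; exact: zm|exact: zpos'].
  rewrite (eq_integral (mu := mu) (fun s => rbk_gain a (c s) j - rbk_loss a (c s) j)%E);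
    last by move=> s; rewrite inE/= in_itv/= => /andP[_ st]; rewrite zlow.
  rewrite (eq_integral (mu := mu) (D := `]t0, t]) (fun s => (rbk_trunc a p (y s) j)%:E));
    last first.
    move=> s; rewrite inE/= in_itv/= => /andP[t0s st].
    rewrite zhigh// -rbk_rhs_finite_support// => i pi.
    by rewrite yp// (le_trans st).
  (* The equation of [c] at [t0] turns the first two terms into [c t0 j], and the integral equation
     of [y] accounts for the third; adding the endpoint [t0] does not change that integral. *)
  rewrite addeA -cE// -EFin_Rintegral_ocitv// -EFinD zhigh//; congr EFin.
  rewrite yE ?(ltW t0t)// Rintegral_itv_obnd_cbnd//.
  exact: continuous_ocitv_integrable.
Qed.

End solutions.

(** * Positive invariance by iterated short steps *)

Theorem proposition7p1 (R : realType) (a : nat -> nat -> R)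
  (a_sym : forall j k : nat, (0 < j)%N -> (0 < k)%N -> a j k = a k j)
  (a_ge0 : forall j k : nat, (0 < j)%N -> (0 < k)%N -> 0 <= a j k)
  (a_uniq : rbk_uniqueness a) (p : nat) (p_gt0 : (0 < p)%N) :
  rbk_positively_invariant a (@Xle R p).
Proof.
move=> T c0 c sol tau tauT [_ ctau] t tT taut.
have [B B0 cB] := rbk_solution_bounded _ _ _ _ sol.
have [d d0 local] := rbk_trunc_local_existence a p B a_ge0 B0.
(* The glued function is a second solution from [c0], so it equals [c]; after [t0] it is [y], which
   vanishes beyond [p]. *)
have step t0 : time_dom T t0 -> (forall j, (p < j)%N -> c t0 j = 0) ->
    forall s, time_dom T s -> t0 <= s < t0 + d ->
    forall j, (p < j)%N -> c s j = 0.
  move=> t0T ct0 s sT /andP[t0s std] j pj.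
  have [y [cy ylow yB yp yE]] := local t0 (c t0) (fun j => cB t0 j t0T) ct0.
  have solz := rbk_solution_glue a a_ge0 T c0 c p t0 d (B + 1) y
    sol t0T d0 cy ylow yB yp yE.
  have solc : rbk_solution a (Order.min T (t0 + d)%:E) c0 c.
    apply: rbk_solution_restrict sol _ _; last by rewrite ge_min lexx.
    exact: rbk_T_gt0 solz.
  have sdom : time_dom (Order.min T (t0 + d)%:E) s.
    by case: sT => s0 sT; split => //; rewrite lt_min sT lte_fin.
  rewrite (a_uniq _ _ _ _ solc solz s sdom j (leq_ltn_trans (leq0n p) pj)).
  (* The first case is only [s = t0], as [t0 <= s]. *)
  case: leP => [st0|_]; last by rewrite yp// ltW.
  by rewrite (@le_anti _ _ s t0 _) ?st0// ct0.
split; first exact: (rbk_X1plus sol).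
(* A step reaches only times [s < t0 + d]; advancing by [d / 2] stays strictly inside. *)
have steps n : forall s, time_dom T s -> tau <= s <= tau + n%:R * (d / 2) ->
    forall j, (p < j)%N -> c s j = 0.
  elim: n => [|n ih] s sT /andP[taus sn].
    have -> : s = tau by apply/eqP; rewrite eq_le taus andbT; lra.
    exact: ctau.
  (* Going back by [d / 2], but not before [tau], gives a starting time covered by the induction
     hypothesis. *)
  pose t0 := Num.max tau (s - d / 2).
  have tau0 : 0 <= tau by case: tauT.
  have t0s : t0 <= s by rewrite ge_max taus; lra.
  have st0 : s < t0 + d.
    have : s - d / 2 <= t0 by rewrite le_max lexx orbT.
    lra.
  have t0T : time_dom T t0.
    split; first by rewrite le_max tau0.
    by case: sT => _; apply: le_lt_trans; rewrite lee_fin.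
  apply: (step t0) => //; last by rewrite t0s.
  apply: ih => //; rewrite le_max lexx ge_max lerDl/=.
  by apply/andP; split; [rewrite mulr_ge0// ltW// divr_gt0|];
     move: sn; rewrite -natr1; lra.
have : 0 <= (t - tau) / (d / 2) by rewrite divr_ge0 ?subr_ge0 ?divr_ge0// ltW.
move=> /archi_boundP; set n := Num.bound _ => tn.
apply: (steps n) => //; rewrite taut/=.
by move: tn; rewrite ltr_pdivrMr ?divr_gt0//; lra.
Qed.
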